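(* Let $q$ be a prime power. For every integer $k=1,2,\ldots,q-1$ there is in $\mathrm{PG}(4,q)$ a $q$-added maximal partial line spread of size $q^{2}+kq+1$.
   Context: $\mathrm{PG}(4,q)$ denotes the projective space of dimension four over the Galois field $\mathrm{GF}(q)$ of order $q$ (its points, lines and hyperplanes are the subspaces of $\mathrm{GF}(q)^5$ of vector-space dimension $1$, $2$ and $4$ respectively). Two lines are skew if they have no point in common. A partial line spread in $\mathrm{PG}(4,q)$ is a set of pairwise skew lines; it is maximal if it cannot be extended to a larger partial line spread. A line spread of a hyperplane $\mathcal{H}$ (a $\mathrm{PG}(3,q)$) is a set of pairwise skew lines of $\mathcal{H}$ covering all points of $\mathcal{H}$. A $q$-added maximal partial line spread is a maximal partial line spread of $\mathrm{PG}(4,q)$ obtained by the following procedure. Start from a line spread $\mathcal{F}_{\mathcal{H}}$ of a hyperplane $\mathcal{H}$ of $\mathrm{PG}(4,q)$. Remove from $\mathcal{F}_{\mathcal{H}}$ a line $r_1$ and add $q+1$ pairwise skew lines not contained in $\mathcal{H}$ and covering $r_1$ (i.e. each point of $r_1$ lies on one of them), obtaining a maximal partial line spread $\mathcal{F}_{\mathcal{H}}'$. Then remove from $\mathcal{F}_{\mathcal{H}}'$ a line $r_2$ contained in $\mathcal{H}$ and add $q+1$ pairwise skew lines not contained in $\mathcal{H}$, covering $r_2$ and not meeting any of the previously added lines, obtaining a maximal partial line spread $\mathcal{F}_{\mathcal{H}}''$; and so on, for a finite number (at least one) of steps. *)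

(* Defs.v *)
From HB Require Import structures.
From mathcomp Require Import all_boot all_algebra.

Set Implicit Arguments.
Unset Strict Implicit.
Unset Printing Implicit Defensive.

(* For the subType structure of {vspace vT}, used by the two instances below. *)
Import VectorInternalTheory.

(* Over a finite field there are finitely many subspaces, so that sets of
   lines can be taken in {set {vspace vT}}. *)
HB.instance Definition _ (F : finFieldType) (vT : vectType F) :=
  [Countable of {vspace vT} by <:].
HB.instance Definition _ (F : finFieldType) (vT : vectType F) :=
  [Finite of {vspace vT} by <:].

Section PG4.

Variable F : finFieldType.

(* Subspaces of PG(4,q), q = #|F|, in vector-space terms: the projective
   dimension is \dim - 1. *)
Local Notation subsp := {vspace 'rV[F]_5}.

Implicit Types (P l m r H : subsp) (S A N : {set subsp}).

Definition pg_point P := \dim P == 1.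
Definition pg_line l := \dim l == 2.
Definition pg_hyperplane H := \dim H == 4.

Definition skew_lines l m :=
  ~~ [exists P, [&& pg_point P, (P <= l)%VS & (P <= m)%VS]].

Definition pairwise_skew S :=
  [forall l in S, forall m in S, (l != m) ==> skew_lines l m].

Definition covers S (U : subsp) :=
  [forall P, pg_point P && (P <= U)%VS ==> [exists l in S, (P <= l)%VS]].

Definition partial_line_spread S :=
  [forall l in S, pg_line l] && pairwise_skew S.

Definition maximal_partial_line_spread S := maxset partial_line_spread S.

Definition line_spread_of H S :=
  [&& partial_line_spread S, [forall l in S, (l <= H)%VS] & covers S H].

(* [replacement H FH n S A]: n steps of the procedure lead from the line
   spread FH of H to S, A being the set of all lines added on the way. *)
Inductive replacement H (FH : {set subsp}) :
    nat -> {set subsp} -> {set subsp} -> Prop :=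
| Replacement0 : replacement H FH 0 FH set0
| ReplacementS n S A r N of
    replacement H FH n S A
  & r \in S
  & (r <= H)%VS
  & partial_line_spread N
  & #|N| = #|F|.+1
  & (forall l, l \in N -> ~~ (l <= H)%VS)
  & covers N r
  & (forall l m, l \in N -> m \in A -> skew_lines l m)
  & maximal_partial_line_spread (S :\ r :|: N) :
    replacement H FH n.+1 (S :\ r :|: N) (A :|: N).

Definition q_added_maximal_partial_line_spread S :=
  exists H FH n A,
    [/\ pg_hyperplane H, line_spread_of H FH, (0 < n)%N
      & replacement H FH n S A].

End PG4.

(* Main.v *)
Require Import Defs.
From mathcomp Require Import all_boot all_algebra finfield zify ring.

Set Implicit Arguments.
Unset Strict Implicit.
Unset Printing Implicit Defensive.

Import GRing.Theory.

(** Every line meets the hyperplane [H], so a partial line spread that covers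
    the points of [H] is automatically maximal ([covering_maximal]); hence
    the maximality demanded at every step of the procedure is free, and one
    only has to find the new lines.

    They can be chosen greedily.  A line not contained in [H] meets [H] in
    exactly one point, so the lines added so far are told apart by their
    points on [H], which all lie on removed lines.  Suppose [m] lines outside
    [H] have been added and [P] is a point of [H] on none of them.  For a
    vector [v] outside [H], the line joining [P] to [v] meets an added line
    [l] only if [v] lies in the plane spanned by [P] and [l], and this plane
    has q^3 - q^2 vectors outside [H].  As V has q^5 - q^4 such vectors, a
    line through [P] skew to all added lines exists as long as m < q^2
    ([exists_skew_line]).  One step adds q + 1 lines, one through each point
    of the removed line, and q - 1 steps add (q - 1) * (q + 1) = q^2 - 1
    lines in total, so up to q - 1 steps never run out of room
    ([exists_replacement]); each of them increases the size by q.

    The procedure starts from a regular spread of [H], of size q^2 + 1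
    ([exists_line_spread]).  Choose c such that X^2 - X - c has no root in F
    and an endomorphism [J] preserving [H] with J^2 = J + c on [H]; then [J]
    has no eigenvector in [H] and makes [H] a vector space of dimension 2 over
    the field F[J] of order q^2, whose one-dimensional subspaces are the lines
    spanned by [v] and [J v], v in [H] nonzero. *)

Section Projective.

Variable F : finFieldType.

Local Notation q := #|F|.
Local Notation V := 'rV[F]_5.
Local Notation subsp := {vspace V}.

Implicit Types (P Q l m r H U : subsp) (S A N : {set subsp}) (u v w : V).

(** * Incidence in PG(4,q) *)

Lemma pointP P : reflect (exists2 v, v != 0%R & P = <[v]>%VS) (pg_point P).
Proof.
apply: (iffP eqP) => [dimP | [v nz_v ->]]; last by rewrite dim_vline nz_v.
have nz_v : vpick P != 0%R by rewrite vpick0 -dimv_eq0 dimP.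
exists (vpick P) => //; apply/eqP; rewrite eq_sym eqEdim -memvE memv_pick.
by rewrite dim_vline nz_v dimP.
Qed.

Lemma point_eq P Q : pg_point P -> pg_point Q -> (P <= Q)%VS -> P = Q.
Proof.
move=> /eqP dimP /eqP dimQ sPQ.
by apply/eqP; rewrite eqEdim sPQ dimP dimQ.
Qed.

Lemma skewP l m : reflect (l :&: m = 0)%VS (skew_lines l m).
Proof.
apply: (iffP existsPn) => [skew | lm0 P].
  apply/eqP; rewrite -vpick0; apply: contraT => nz_v.
  have /andP[vl vm] : (vpick (l :&: m) \in l) && (vpick (l :&: m) \in m).
    by rewrite -memv_cap memv_pick.
  have /negP[] := skew <[vpick (l :&: m)]>%VS.
  by rewrite /pg_point dim_vline nz_v -!memvE vl vm.
apply/negP => /and3P[/eqP dimP Pl Pm].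
have: (P <= l :&: m)%VS by rewrite subv_cap Pl.
by rewrite lm0 subv0 -dimv_eq0 dimP.
Qed.

Lemma partial_line_spreadP S :
  reflect ({in S, forall l, pg_line l} /\
           {in S &, forall l m, l != m -> (l :&: m = 0)%VS})
          (partial_line_spread S).
Proof.
apply: (iffP andP) => -[lineS skewS]; split.
- exact/forall_inP.
- move=> l m lS mS neq_lm; apply/skewP.
  by move/forall_inP/(_ l lS)/forall_inP/(_ m mS)/implyP: skewS; apply.
- exact/forall_inP.
- apply/forall_inP => l lS; apply/forall_inP => m mS; apply/implyP => neq.
  exact/skewP/skewS.
Qed.

Lemma coversP S U :
  reflect
    (forall P, pg_point P -> (P <= U)%VS -> exists2 l, l \in S & (P <= l)%VS)
    (covers S U).
Proof.
apply: (iffP forallP) => [cov P pP PU | cov P].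
  by have := cov P; rewrite pP PU /= => /exists_inP.
by apply/implyP => /andP[pP PU]; apply/exists_inP/cov.
Qed.

(** A subspace outside [H] spans the whole space together with [H], so
    cutting by [H] costs exactly one dimension. *)
Lemma dim_cap_hyperplane H U :
  pg_hyperplane H -> ~~ (U <= H)%VS -> (\dim (U :&: H)).+1 = \dim U.
Proof.
move=> /eqP dimH UH.
have := dimv_sum_cap U H.
have : \dim (U + H) <= 5 by apply: leq_trans (dimvS (subvf _)) _; rewrite dimvf.
have : 4 < \dim (U + H).
  rewrite ltnNge; apply: contra UH => dim4.
  have /eqP -> : H == (U + H)%VS by rewrite eqEdim addvSr dimH.
  exact: addvSl.
rewrite dimH; lia.
Qed.

Lemma line_meets_hyperplane H l :
  pg_hyperplane H -> pg_line l -> exists2 P, pg_point P & (P <= l :&: H)%VS.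
Proof.
move=> hypH /eqP dim_l.
have nz_v : vpick (l :&: H) != 0%R.
  rewrite vpick0 -dimv_eq0; have [/capv_idPl -> | lH] := boolP (l <= H)%VS.
    by rewrite dim_l.
  by have := dim_cap_hyperplane hypH lH; rewrite dim_l => -[->].
exists <[vpick (l :&: H)]>%VS; last by rewrite -memvE memv_pick.
by rewrite /pg_point dim_vline nz_v.
Qed.

(** A line that could be added would meet [H] in a point, and the line of [S]
    through this point is not skew to it. *)
Lemma covering_maximal H S :
  pg_hyperplane H -> partial_line_spread S -> covers S H ->
  maximal_partial_line_spread S.
Proof.
move=> hypH plsS /coversP covS; apply/maxsetP; split=> // T.
move=> /partial_line_spreadP[lineT skewT] sST.
apply/eqP; rewrite eqEsubset sST andbT; apply/subsetP => l lT.
have [P pP] := line_meets_hyperplane hypH (lineT l lT).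
rewrite subv_cap => /andP[Pl PH].
have [m mS Pm] := covS P pP PH.
have [-> // | neq_lm] := eqVneq l m.
have: (P <= l :&: m)%VS by rewrite subv_cap Pl.
by rewrite (skewT l m lT (subsetP sST m mS) neq_lm) subv0 -dimv_eq0 (eqP pP).
Qed.

(** * Counting *)

Definition nonzero U := [set v in U | v != 0%R].

Lemma card_nonzero U : #|nonzero U| = q ^ \dim U - 1.
Proof.
have := card_vspace U; rewrite (cardD1 0%R) mem0v add1n => <-.
rewrite subn1; apply: eq_card => v.
by rewrite !inE andbC.
Qed.

(** If each nonzero vector [v] of [U] has a block [L v] which is also the
    block of all its other nonzero vectors, then the blocks partition
    [nonzero U].  Used both for the points of a line ([d = 1]) and for the
    lines of a spread ([d = 2]). *)
Lemma card_imset_nonzero U (L : V -> subsp) d :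
  {in nonzero U, forall v, [/\ v \in L v, (L v <= U)%VS & \dim (L v) = d]} ->
  {in nonzero U, forall v, {in nonzero (L v), forall w, L w = L v}} ->
  #|L @: nonzero U| * (q ^ d - 1) = q ^ \dim U - 1.
Proof.
move=> propL eqL; rewrite -card_nonzero -[RHS]sum1_card.
rewrite (partition_big_imset L) /= -sum_nat_const.
apply: eq_bigr => _ /imsetP[v vU ->]; rewrite sum1dep_card.
have [_ LvU <-] := propL v vU; rewrite -card_nonzero; apply: eq_card => w.
rewrite [RHS]inE; apply/idP/andP => [wL | [wU /eqP <-]].
  split; last exact/eqP/eqL.
  by move: wL; rewrite !inE => /andP[/(subvP LvU) -> ->].
by have [wL _ _] := propL w wU; move: wU; rewrite !inE wL => /andP[].
Qed.

Definition points U := [set <[v]>%VS | v : V in nonzero U].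

Lemma mem_points U P : (P \in points U) = pg_point P && (P <= U)%VS.
Proof.
apply/imsetP/andP => [[v] | [/pointP[v nz_v ->] vU]].
  rewrite inE => /andP[vU nz_v] ->; split; last by rewrite -memvE.
  by apply/pointP; exists v.
by exists v; rewrite // inE nz_v memvE vU.
Qed.

Lemma card_points_line l : pg_line l -> #|points l| = q.+1.
Proof.
move=> /eqP dim_l; have q_gt1 := finNzRing_gt1 F.
have := @card_imset_nonzero l (fun v : V => <[v]>%VS) 1.
rewrite dim_l -/(points l).
have -> : q ^ 2 - 1 = q.+1 * (q ^ 1 - 1).
  by rewrite expn1 -(addn1 q) mulnC -subn_sqr exp1n.
move=> card_eq; apply/eqP.
have q1_gt0 : 0 < q ^ 1 - 1 by rewrite expn1 subn_gt0.
rewrite -(eqn_pmul2r q1_gt0) card_eq // => [v | v _ w].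
  rewrite inE => /andP[vl nz_v].
  by rewrite memv_line -memvE vl dim_vline nz_v.
rewrite inE => /andP[wv nz_w].
apply/eqP; rewrite eqEdim -memvE wv !dim_vline nz_w; by case: (v == 0%R).
Qed.

Lemma card_bigcup_leq (I T : finType) (A : {set I}) (B : I -> {set T}) b :
  {in A, forall i, #|B i| <= b} -> #|\bigcup_(i in A) B i| <= #|A| * b.
Proof.
move=> leB; rewrite -sum_nat_const.
apply: (big_ind2 (fun (X : {set T}) n => #|X| <= n)) => [| X m Y n Xm Yn |].
- by rewrite cards0.
- by rewrite (leq_trans (leq_card_setU X Y)) // leq_add.
- exact: leB.
Qed.

(** * Greedy choice of the added lines *)

(** Vectors in [H], or in a plane [P + l] for some [l] in [A], are bad: there
    are at most q^4 + #|A| * (q^3 - q^2) of them, which is less than q^5.  If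
    [v] is not bad and [p + b *: v] lies on [l] with [p] in [P], then b = 0
    since otherwise [v] would be in [P + l], and then [p = 0] since [P] is
    not on [l]. *)
Lemma exists_skew_line H P A :
    pg_hyperplane H -> pg_point P -> (P <= H)%VS ->
    {in A, forall l, [/\ pg_line l, ~~ (l <= H)%VS & ~~ (P <= l)%VS]} ->
    #|A| < q ^ 2 ->
  exists l, [/\ pg_line l, (l :&: H = P)%VS
               & {in A, forall m, (l :&: m = 0)%VS}].
Proof.
move=> hypH pP PH propA ltA; have q_gt1 := finNzRing_gt1 F.
pose bad := [set v in H] :|:
  \bigcup_(l in A) ([set v in (P + l)%VS] :\: [set v in H]).
have card_mem U : #|[set v in U]| = q ^ \dim U by rewrite cardsE card_vspace.
have card_bad : #|bad| <= q ^ 4 + #|A| * (q ^ 3 - q ^ 2).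
  apply: leq_trans (leq_card_setU _ _) _.
  rewrite card_mem (eqP hypH) leq_add2l; apply: card_bigcup_leq => l lA.
  have [/eqP dim_l lH Pl] := propA l lA.
  have nPlH : ~~ (P + l <= H)%VS by apply: contra lH; apply/subv_trans/addvSr.
  have dimPl : \dim (P + l) <= 3.
    by rewrite (leq_trans (dimv_add_leqif _ _).1) // (eqP pP) dim_l.
  have dimPl3 : 2 < \dim (P + l).
    rewrite ltnNge; apply: contra Pl => dim2.
    have /eqP -> : l == (P + l)%VS by rewrite eqEdim addvSr dim_l.
    exact: addvSl.
  have := cardsID [set v in H] [set v in (P + l)%VS].
  have -> : [set v in (P + l)%VS] :&: [set v in H] =
            [set v in ((P + l) :&: H)%VS].
    by apply/setP => v; rewrite !inE memv_cap.
  have := dim_cap_hyperplane hypH nPlH.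
  have -> : \dim (P + l) = 3 by lia.
  move=> [dim2]; rewrite !card_mem dim2.
  have -> : \dim (P + l) = 3 by lia.
  lia.
have [v] : exists v, v \notin bad.
  apply/existsP; rewrite -negb_forall; apply/negP => /forallP all_bad.
  have : #|V| <= #|bad| by apply/subset_leq_card/subsetP => v _; apply: all_bad.
  rewrite card_mx mul1n => /leq_trans/(_ card_bad).
  have -> : q ^ 5 = q ^ 4 + q ^ 2 * (q ^ 3 - q ^ 2).
    by rewrite mulnBr -!expnD; nia.
  have gap_gt0 : 0 < q ^ 3 - q ^ 2 by rewrite subn_gt0 ltn_exp2l.
  by rewrite leq_add2l (leq_pmul2r gap_gt0) leqNgt ltA.
rewrite !inE negb_or => /andP[vH /bigcupP v_avoid].
pose l := (P + <[v]>)%VS; exists l.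
have lH : ~~ (l <= H)%VS.
  by apply: contra vH => /(subv_trans (addvSr _ _)); rewrite -memvE.
have PlH : (P <= l :&: H)%VS by rewrite subv_cap addvSl.
have := dim_cap_hyperplane hypH lH => dim_lH.
have dim_l : \dim l <= 2.
  rewrite (leq_trans (dimv_add_leqif _ _).1) // (eqP pP) dim_vline.
  by case: (v != 0%R).
have dimP := eqP pP; have := dimvS PlH; rewrite dimP => dim_ge1.
split; first by rewrite /pg_line; lia.
  by apply/esym/eqP; rewrite eqEdim PlH dimP; lia.
move=> m mA; apply/eqP; rewrite -subv0; apply/subvP => w.
rewrite memv_cap => /andP[/memv_addP[p pPw [_ /vlineP[b ->] ->]] wm].
have [_ _ Pm] := propA m mA.
have [b0 | nz_b] := eqVneq b 0%R.
  move: wm; rewrite b0 scale0r addr0 memv0 => pm.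
  apply: contraNT Pm => nz_p.
  suff <- : <[p]>%VS = P by rewrite -memvE.
  by apply: point_eq; rewrite -?memvE //; apply/pointP; exists p.
case: v_avoid; exists m => //; rewrite !inE vH; apply/memv_addP.
exists (- (b^-1 *: p))%R; first by rewrite memvN memvZ.
exists (b^-1 *: (p + b *: v))%R; first by rewrite memvZ.
by rewrite scalerDr scalerA mulVf // scale1r addKr.
Qed.

(** The new lines are found one at a time.  The induction keeps track of
    [l :&: H] for each new line [l], which ensures that the next point of [s]
    is on none of the earlier ones. *)
Lemma exists_transversal_lines H A (s : seq subsp) :
    pg_hyperplane H -> uniq s ->
    {in s, forall P, pg_point P && (P <= H)%VS} ->
    {in A, forall l, pg_line l && ~~ (l <= H)%VS} ->
    {in s & A, forall P l, ~~ (P <= l)%VS} ->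
    #|A| + size s <= q ^ 2 ->
  exists N, [/\ partial_line_spread N, #|N| = size s,
    {in N, forall l, (l :&: H)%VS \in s},
    {in s, forall P, exists2 l, l \in N & (P <= l)%VS}
  & {in N & A, forall l m, (l :&: m = 0)%VS}].
Proof.
move=> hypH; elim: s => [|P s IHs] /=.
  move=> *; exists set0; split; rewrite ?cards0 //; try by move=> l; rewrite inE.
  by apply/partial_line_spreadP; split=> [l | l m]; rewrite inE.
move=> /andP[Ps uniq_s] propPs propA PsA leA.
have propP := propPs P (mem_head P s).
have props : {in s, forall P, pg_point P && (P <= H)%VS}.
  by move=> Q Qs; apply: propPs; rewrite inE Qs orbT.
case: IHs => // [Q l Qs lA | | N [plsN cardN capN coverN skewNA]].
- by apply: PsA; rewrite // inE Qs orbT.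
- by apply: leq_trans leA; rewrite leq_add2l.
have [lineN skewN] := partial_line_spreadP _ plsN.
have {propP}/andP[pP PH] := propP.
have [//|//|//|||l [line_l lHP skew_l]] := @exists_skew_line H P (A :|: N).
- move=> l; rewrite inE => /orP[lA | lN].
    have /andP[line_l lH] := propA l lA; split=> //.
    by apply: PsA => //; apply: mem_head.
  have line_l := lineN l lN; have /andP[plH _] := props _ (capN l lN).
  split=> //.
    by apply: contraTN plH => /capv_idPl ->; rewrite /pg_point (eqP line_l).
  apply: contra Ps => Pl; have -> // : P = (l :&: H)%VS; last exact: capN.
  by apply: point_eq; rewrite // subv_cap Pl.
- by apply: leq_ltn_trans (leq_card_setU A N) _; rewrite cardN -addnS.
have nz_l : (l :&: l)%VS != 0%VS by rewrite capvv -dimv_eq0 (eqP line_l).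
have lN : l \notin N.
  by apply: contra nz_l => lN; rewrite (skew_l l) // inE lN orbT.
exists (l |: N); split.
- apply/partial_line_spreadP; split=> [m /setU1P[-> | /lineN] // | m1 m2].
  move=> /setU1P[-> | m1N] /setU1P[-> | m2N]; rewrite ?eqxx // => neq.
  + by apply: skew_l; rewrite inE m2N orbT.
  + by rewrite capvC; apply: skew_l; rewrite inE m1N orbT.
  + exact: skewN.
- by rewrite cardsU1 lN cardN.
- by move=> m /setU1P[-> | /capN mHs]; rewrite inE ?lHP ?eqxx ?mHs ?orbT.
- move=> Q; rewrite inE => /predU1P[-> | /coverN[m mN Qm]].
    by exists l; [exact: setU11 | rewrite -lHP capvSl].
  by exists m; rewrite // inE mN orbT.
- move=> m1 m2 /setU1P[-> | m1N] m2A; last exact: skewNA.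
  by apply: skew_l; rewrite inE m2A.
Qed.

(** Besides the properties required by the procedure, the new lines meet [H]
    only inside [r]; this makes them skew to every line of [H] that is skew
    to [r]. *)
Lemma exists_replacement_lines H A r :
    pg_hyperplane H -> pg_line r -> (r <= H)%VS ->
    {in A, forall l, [/\ pg_line l, ~~ (l <= H)%VS & (r :&: l = 0)%VS]} ->
    #|A| + q.+1 <= q ^ 2 ->
  exists N, [/\ partial_line_spread N, #|N| = q.+1,
    {in N, forall l, ~~ (l <= H)%VS && (l :&: H <= r)%VS},
    covers N r & {in N & A, forall l m, (l :&: m = 0)%VS}].
Proof.
move=> hypH line_r rH propA leA.
have mem_s P : (P \in enum (points r)) = pg_point P && (P <= r)%VS.
  by rewrite mem_enum mem_points.
have [//|||||| N [plsN cardN capN coverN skewN]] :=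
  @exists_transversal_lines H A (enum (points r)).
- exact: enum_uniq.
- by move=> P; rewrite mem_s => /andP[-> Pr]; apply: subv_trans Pr rH.
- by move=> l /propA[-> ->].
- move=> P l; rewrite mem_s => /andP[pP Pr] /propA[_ _ rl0].
  apply/negP => Pl; have: (P <= r :&: l)%VS by rewrite subv_cap Pr.
  by rewrite rl0 subv0 -dimv_eq0 (eqP pP).
- by rewrite -cardE card_points_line.
have [lineN _] := partial_line_spreadP _ plsN.
exists N; split=> //.
- by rewrite cardN -cardE card_points_line.
- move=> l lN; have := capN l lN; rewrite mem_s => /andP[plH ->]; rewrite andbT.
  by apply: contraTN plH => /capv_idPl ->; rewrite /pg_point (eqP (lineN l lN)).
- by apply/coversP => P pP Pr; apply: coverN; rewrite mem_s pP.
Qed.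

(** * A regular spread of a hyperplane *)

(** The map x -> x^2 - x takes the same value at 0 and 1, so it is not
    injective and, the field being finite, not surjective; any [c] outside
    its image works. *)
Lemma exists_irreducible_quadratic :
  exists c : F, forall x : F, (x * x != x + c)%R.
Proof.
pose f (x : F) := (x * x - x)%R.
have [c cf] : exists c, c \notin codom f.
  apply/existsP; rewrite -negb_forall; apply/negP => /forallP onto_f.
  have /image_injP f_inj : #|codom f| == #|F|.
    rewrite eqn_leq leq_image_card.
    by apply/subset_leq_card/subsetP => c _; apply: onto_f.
  have /eqP : (1 : F)%R = 0%R by apply: f_inj; rewrite // /f mulr1 mulr0 !subrr.
  by rewrite oner_eq0.
exists c => x; apply: contra cf => /eqP eq_x; apply/codomP; exists x.
by rewrite /f eq_x addrC addKr.
Qed.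

Section RegularSpread.

(* On [H], [J] is multiplication by a root of the irreducible polynomial
   X^2 - X - c, which generates a field of order q^2. *)
Variables (H : subsp) (J : 'End(V)) (c : F).
Hypothesis J_stable : {in H, forall v, J v \in H}.
Hypothesis J_quadratic : {in H, forall v, J (J v) = J v + c *: v}%R.
Hypothesis c_irreducible : forall x, (x * x != x + c)%R.

(** The line of the field F[J] through [v]. *)
Definition J_line v := (<[v]> + <[J v]>)%VS.

Lemma mem_J_line v : v \in J_line v.
Proof. by rewrite memvE addvSl. Qed.

Lemma J_line_sub : {in H, forall v, J_line v <= H}%VS.
Proof. by move=> v vH; rewrite subv_add -!memvE vH J_stable. Qed.

(** Otherwise [v] would be an eigenvector of [J], and its eigenvalue a root of
    X^2 - X - c. *)
Lemma dim_J_line v : v \in H -> v != 0%R -> \dim (J_line v) = 2.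
Proof.
move=> vH nz_v; apply/eqP; rewrite eqn_leq; apply/andP; split.
  rewrite (leq_trans (dimv_add_leqif _ _).1) // !dim_vline.
  by case: (v != 0%R); case: (J v != 0%R).
rewrite ltnNge; apply/negP => dim1.
have /eqP eqJ : <[v]>%VS == J_line v by rewrite eqEdim addvSl dim_vline nz_v.
have /vlineP[x Jv] : J v \in <[v]>%VS by rewrite eqJ memvE addvSr.
have /eqP := J_quadratic vH; rewrite Jv linearZ /= Jv scalerA -scalerDl.
rewrite -subr_eq0 -scalerBl scaler_eq0 (negPf nz_v) orbF subr_eq0.
exact/negP.
Qed.

(** By the quadratic relation [J_line v] is stable under [J], hence contains
    [J_line w], which has the same dimension. *)
Lemma J_line_eq v w : v \in H -> v != 0%R -> w \in J_line v -> w != 0%R ->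
  J_line w = J_line v.
Proof.
move=> vH nz_v wv nz_w.
have wH : w \in H by apply: subvP wv; apply: J_line_sub.
apply/eqP; rewrite eqEdim !dim_J_line // leqnn andbT subv_add -!memvE wv /=.
have Jv : J v \in J_line v by rewrite memvE addvSr.
have /memv_addP[_ /vlineP[a ->] [_ /vlineP[b ->] ->]] := wv.
rewrite linearD !linearZ /= J_quadratic //.
by rewrite !(memvD, memvZ) // mem_J_line.
Qed.

Definition regular_spread := J_line @: nonzero H.

Lemma regular_spread_spread : line_spread_of H regular_spread.
Proof.
apply/and3P; split.
- apply/partial_line_spreadP; split=> [l | l m] /imsetP[v].
    by rewrite inE => /andP[vH nz_v] ->; apply/eqP/dim_J_line.
  move=> vH -> /imsetP[w wH ->].
  apply: contraNeq; rewrite -vpick0 => nz_u.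
  have := memv_pick (J_line v :&: J_line w); rewrite memv_cap => /andP[uv uw].
  move: vH wH; rewrite !inE => /andP[vH nz_v] /andP[wH nz_w].
  by rewrite -(J_line_eq vH nz_v uv nz_u) (J_line_eq wH nz_w uw nz_u).
- apply/forall_inP => l /imsetP[v]; rewrite inE => /andP[vH _] ->.
  exact: J_line_sub.
- apply/coversP => _ /pointP[v nz_v ->]; rewrite -memvE => vH.
  exists (J_line v); last by rewrite -memvE mem_J_line.
  by apply: imset_f; rewrite inE vH.
Qed.

Lemma card_regular_spread : \dim H = 4 -> #|regular_spread| = q ^ 2 + 1.
Proof.
move=> dimH; have q_gt1 := finNzRing_gt1 F.
have q2_gt0 : 0 < q ^ 2 - 1 by rewrite subn_gt0 -(exp1n 2) ltn_exp2r.
apply/eqP; rewrite -(eqn_pmul2r q2_gt0).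
rewrite (@card_imset_nonzero H J_line 2) ?dimH.
- by rewrite mulnC -subn_sqr exp1n -expnM.
- move=> v; rewrite inE => /andP[vH nz_v].
  by rewrite mem_J_line dim_J_line // J_line_sub.
- move=> v; rewrite inE => /andP[vH nz_v] w; rewrite inE => /andP[wv nz_w].
  exact: J_line_eq.
Qed.

End RegularSpread.

Lemma exists_line_spread :
  exists H FH, [/\ pg_hyperplane H, line_spread_of H FH & #|FH| = q ^ 2 + 1].
Proof.
have [c c_irr] := exists_irreducible_quadratic.
pose last_coord : 'Hom(V, 'M[F]_1) := linfun (mulmxr (delta_mx (inord 4) 0)%R).
have last_coordE v : (last_coord v == 0%R) = (v 0 (inord 4) == 0)%R.
  rewrite lfunE /= -colE; apply/eqP/eqP => [/matrixP/(_ 0 0)%R | v4].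
    by rewrite !mxE.
  by apply/matrixP => i j; rewrite !mxE !ord1.
pose H := lker last_coord.
have dimH : \dim H = 4.
  have := limg_ker_dim last_coord fullv; rewrite capfv dimvf /=.
  have : \dim (limg last_coord) <= 1.
    by apply: leq_trans (dimvS (subvf _)) _; rewrite dimvf.
  have : 0 < \dim (limg last_coord).
    rewrite lt0n dimv_eq0; apply/negP => /eqP img0.
    have := memv_img last_coord (memvf (delta_mx 0 (inord 4))%R).
    by rewrite img0 memv0 last_coordE mxE !eqxx oner_eq0.
  rewrite -/H; have -> : dim V = 5 by []. lia.
(* Two copies of the companion block of X^2 - X - c, acting on rows, and a
   zero last row and column; the missing entries default to 0. *)
pose Jmx : 'M[F]_5 := (\matrix_(i, j) nth 0
  (nth [::] [:: [:: 0; 1]; [:: c; 1]; [:: 0; 0; 0; 1]; [:: 0; 0; c; 1]] i) j)%R.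
pose J : 'End(V) := linfun (mulmxr Jmx).
have JE v : J v =
    (\row_j nth 0 [:: c * v 0 (inord 1); v 0 (inord 0) + v 0 (inord 1);
                      c * v 0 (inord 3); v 0 (inord 2) + v 0 (inord 3)] j)%R.
  apply/rowP => j; rewrite lfunE /= !mxE.
  under eq_bigr => i _ do rewrite mxE -[in v 0%R i](inord_val i).
  rewrite !big_ord_recl big_ord0 /= /bump /=.
  by case: j => -[|[|[|[|[|//]]]]] ltj /=; ring.
have J_coord v k : k < 5 -> J v 0%R (inord k) =
    (nth 0 [:: c * v 0 (inord 1); v 0 (inord 0) + v 0 (inord 1);
               c * v 0 (inord 3); v 0 (inord 2) + v 0 (inord 3)] k)%R.
  by move=> lt_k; rewrite JE mxE inordK.
have J_stable : {in H, forall v, J v \in H}.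
  by move=> v _; rewrite memv_ker last_coordE J_coord.
have J_quadratic : {in H, forall v, J (J v) = J v + c *: v}%R.
  move=> v; rewrite memv_ker last_coordE => /eqP v4.
  apply/rowP => i; rewrite -(inord_val i) 2!mxE !J_coord //.
  by case: i => -[|[|[|[|[|//]]]]] lti /=; rewrite ?v4 ?J_coord //=; ring.
exists H, (regular_spread H J); split; first exact/eqP.
  exact: regular_spread_spread J_stable J_quadratic c_irr.
exact: card_regular_spread J_stable J_quadratic c_irr dimH.
Qed.

(** * The replacement procedure *)

Definition transversal_lines H S := [set l in S | ~~ (l <= H)%VS].

(** Some line of [S] lies in [H] because [S] is larger than [A].  The new
    lines are skew to [A] by choice, and skew to the other lines of [S]
    contained in [H] because they meet [H] inside [r].  Identifying [A] with
    the lines of [S] outside [H] lets the hypotheses be read off [S] alone,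
    so that the step can be iterated. *)
Lemma replacement_step H FH n S A :
    pg_hyperplane H -> replacement H FH n S A ->
    partial_line_spread S -> covers S H ->
    A = transversal_lines H S -> #|A| < #|S| -> #|A| + q.+1 <= q ^ 2 ->
  exists S' A', [/\ replacement H FH n.+1 S' A',
    partial_line_spread S' /\ covers S' H,
    A' = transversal_lines H S',
    #|S'| = #|S| + q & #|A'| = #|A| + q.+1].
Proof.
move=> hypH replS plsS covS defA ltAS leA.
have [lineS skewS] := partial_line_spreadP _ plsS.
have [r rS rH] : exists2 r, r \in S & (r <= H)%VS.
  apply/exists_inP; apply: contraLR ltAS => /exists_inPn all_out.
  rewrite -leqNgt subset_leq_card //; apply/subsetP => l lS.
  by rewrite defA inE lS all_out.
have line_r := lineS r rS.
have [|N [plsN cardN outN covN skewNA]] :=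
  exists_replacement_lines (A := A) hypH line_r rH _ leA.
- move=> l; rewrite defA inE => /andP[lS lH]; split; rewrite ?lineS //.
  by apply: skewS => //; apply: contraNneq lH => <-.
have [lineN skewN] := partial_line_spreadP _ plsN.
have skewNS : {in N & S :\ r, forall l m, (l :&: m = 0)%VS}.
  move=> l m lN /setD1P[neq_mr mS].
  have [mH | mH] := boolP (m <= H)%VS; last first.
    by apply: skewNA; rewrite // defA inE mS.
  have /andP[_ lHr] := outN l lN.
  apply/eqP; rewrite -subv0 -(skewS m r mS rS neq_mr) subv_cap capvSr.
  by apply: subv_trans lHr; apply: capvS.
have disjNS : [disjoint S :\ r & N].
  rewrite disjoint_sym; apply/pred0P => l /=; apply/negP => /andP[lN lS].
  have := skewNS l l lN lS; rewrite capvv => /eqP.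
  by rewrite -dimv_eq0 (eqP (lineN l lN)).
have plsS' : partial_line_spread (S :\ r :|: N).
  apply/partial_line_spreadP; split=> [l /setUP[/setD1P[_ /lineS] | /lineN] // | l m].
  move=> /setUP[lS | lN] /setUP[mS | mN] neq.
  - by apply: skewS neq; [case/setD1P: lS | case/setD1P: mS].
  - by rewrite capvC skewNS.
  - exact: skewNS.
  - exact: skewN.
have covS' : covers (S :\ r :|: N) H.
  apply/coversP => P pP PH; have /coversP/(_ P pP PH)[l lS Pl] := covS.
  have [eq_lr | neq_lr] := eqVneq l r; last by exists l; rewrite // !inE neq_lr lS.
  have /coversP/(_ P pP)[|m mN Pm] := covN; first by rewrite -eq_lr.
  by exists m; rewrite // inE mN orbT.
exists (S :\ r :|: N), (A :|: N); split=> //.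
- apply: ReplacementS => //.
  + by move=> l /outN/andP[].
  + by move=> l m lN mA; apply/skewP/skewNA.
  + exact: covering_maximal covS'.
- apply/setP => l; rewrite defA !inE.
  have [lN | _] := boolP (l \in N); first by rewrite !orbT; have /andP[->] := outN l lN.
  by rewrite !orbF; have [-> | _] := eqVneq l r; rewrite ?rH ?andbF.
- rewrite cardsU disjoint_setI0 // cards0 subn0 cardN.
  by rewrite (cardsD1 r S) rS add1n addSnnS.
- rewrite cardsU cardN; have -> : A :&: N = set0; last by rewrite cards0 subn0.
  apply: disjoint_setI0; apply: disjointWl disjNS; apply/subsetP => l.
  rewrite defA !inE => /andP[-> lH]; rewrite andbT.
  by apply: contraNneq lH => ->.
Qed.

(** The cardinality of [A] is needed to iterate: before step n + 1 it is
    n * (q + 1), and adding q + 1 keeps it at most (q - 1) * (q + 1) < q^2. *)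
Lemma exists_replacement H FH n :
    pg_hyperplane H -> line_spread_of H FH -> #|FH| = q ^ 2 + 1 -> n < q ->
  exists S A, [/\ replacement H FH n S A,
    partial_line_spread S /\ covers S H,
    A = transversal_lines H S,
    #|S| = q ^ 2 + n * q + 1 & #|A| = n * q.+1].
Proof.
move=> hypH /and3P[plsFH /forall_inP subFH covFH] cardFH.
elim: n => [_ | n IHn lt_n].
  exists FH, set0; split; rewrite ?cards0 ?mul0n ?addn0 //; first exact: Replacement0.
  by apply/setP => l; rewrite !inE; apply/esym/andP => -[/subFH ->].
have [S [A [replS [plsS covS] defA cardS cardA]]] := IHn (ltnW lt_n).
have [||S' [A' [? ? ? cardS' cardA']]] := replacement_step hypH replS plsS covS defA.
- by rewrite cardA cardS; nia.
- by rewrite cardA; nia.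
exists S', A'; split=> //; first by rewrite cardS' cardS mulSn; lia.
by rewrite cardA' cardA mulSn addnC.
Qed.

End Projective.

Theorem theorem2p2 (q : nat) (F : finFieldType) (cardF : #|F| = q)
    (k : nat) (k_bounds : 1 <= k <= q - 1) :
  exists S : {set {vspace 'rV[F]_5}},
    q_added_maximal_partial_line_spread S /\ #|S| = q ^ 2 + k * q + 1.
Proof.
have /andP[k_gt0 k_lt] := k_bounds.
have [H [FH [hypH spreadFH cardFH]]] := exists_line_spread F.
have lt_kq : k < #|F| by rewrite cardF; lia.
have [S [A [replS _ _ cardS _]]] := exists_replacement hypH spreadFH cardFH lt_kq.
exists S; split; last by rewrite cardS cardF.
by exists H, FH, k, A.
Qed.
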